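(* Let $n,d$ be positive integers. There exists no fundamental model in $\Delta_n$ of degree $d$ if $d<n$ or $d>2n-1$.
   Context: A reduced model in the probability simplex $\Delta_n=\{p\in\mathbb{R}^{n+1}\mid \sum_i p_i=1,\ p_i\ge 0\}$ is given by a collection of $n+1$ triples $(c_i,\nu_i,\mu_i)_{i=0}^n$ with $c_i\in\mathbb{R}_{>0}$ and $\nu_i,\mu_i\in\mathbb{N}=\{0,1,2,\ldots\}$ such that the pairs $(\nu_i,\mu_i)$ are pairwise distinct and all different from $(0,0)$, and $\sum_{i=0}^n c_i t^{\nu_i}(1-t)^{\mu_i}=1$ for all $t\in[0,1]$. Its degree is $\max_i(\nu_i+\mu_i)$. It is fundamental if, given the exponent pairs $(\nu_i,\mu_i)$, the scalings $c_i$ are uniquely determined by the constraint $\sum_{i=0}^n c_i t^{\nu_i}(1-t)^{\mu_i}=1$ (as a polynomial identity in $t$). *)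

(* Defs.v *)
From mathcomp Require Import all_boot all_order all_algebra.
From mathcomp Require Import reals.

Set Implicit Arguments.
Unset Strict Implicit.
Unset Printing Implicit Defensive.

Import Order.TTheory GRing.Theory Num.Theory.
Local Open Scope ring_scope.

Record reduced_model (R : realType) (n : nat) := ReducedModel {
  scaling : 'I_n.+1 -> R;
  nu : 'I_n.+1 -> nat;
  mu : 'I_n.+1 -> nat;
  scaling_gt0 : forall i, 0 < scaling i;
  exponents_inj : injective (fun i => (nu i, mu i));
  exponents_neq0 : forall i, (nu i, mu i) <> (0%N, 0%N);
  scaling_sum : forall t : R, 0 <= t <= 1 ->
    \sum_(i < n.+1) scaling i * t ^+ nu i * (1 - t) ^+ mu i = 1
}.

Definition degree (R : realType) (n : nat) (M : reduced_model R n) : nat :=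
  \max_(i < n.+1) (nu M i + mu M i).

(* The competing scalings range over the positive reals, as in a model.
   Allowing arbitrary real competitors gives the same notion: the segment from
   a positive solution to a real one contains other positive solutions. *)
Definition fundamental (R : realType) (n : nat) (M : reduced_model R n) : Prop :=
  forall c : 'I_n.+1 -> R, (forall i, 0 < c i) ->
    \sum_(i < n.+1) c i *: ('X^(nu M i) * (1 - 'X) ^+ mu M i) = 1 :> {poly R} ->
    forall i, c i = scaling M i.

(* Main.v *)
Require Import Defs.
From mathcomp Require Import all_boot all_order all_algebra.
From mathcomp Require Import reals.
From mathcomp Require Import zify ring lra.

(**
For d < n, the n + 1 polynomials t^nu (1-t)^mu live in a space of dimension
d + 1 <= n, and a small multiple of a linear relation between them perturbs the
scalings without losing positivity.

For d <= 2n - 1, let p = sum of the c_i x^nu_i y^mu_i and 1 - p = (1 - x - y) q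
with q of degree m = d - 1.  Every homogeneous part of q of degree k <= m is
nonzero, because at x = y = 1/2 it is the sum of the terms of p of degree > k.
Put the signs of the coefficients of q, twisted by (-1)^degree, on the
triangular grid of monomials of degree <= m: wherever p has no term, the two or
three adjacent coefficients of q do not all have the same sign.  Zero
coefficients of q are given signs alternating along each row, without creating
new monochromatic sites.  Among the three edges of an up-triangle at least one
has equal ends, whereas a down-triangle without a term of p has only one such
edge; comparing the two counts row by row forces d + 3 <= 2 (n + 1).
*)

Set Implicit Arguments.
Unset Strict Implicit.
Unset Printing Implicit Defensive.

Import Order.TTheory GRing.Theory Num.Theory.
Local Open Scope ring_scope.

(** * Monochromatic sites of a sign pattern on a triangle *)

(* Position [a] of row [k] stands for the monomial x^a y^(k-a); [tau k a] is its
   sign and [P k a] says that p has this term. *)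
Section RowCount.
Variables (m : nat) (tau P : nat -> nat -> bool) (jx jy : nat).
Hypothesis inner_mixed : forall k a, (k < m)%N -> (a < k)%N -> ~~ P k.+1 a.+1 ->
  ~~ ((tau k a == tau k a.+1) && (tau k a == tau k.+1 a.+1)).
Hypothesis left_mixed : forall k, (k < m)%N -> ~~ P k.+1 0 -> tau k 0 != tau k.+1 0.
Hypothesis right_mixed : forall k, (k < m)%N -> ~~ P k.+1 k.+1 ->
  tau k k != tau k.+1 k.+1.
Hypothesis top_mixed : forall a, (a < m)%N -> ~~ P m.+1 a.+1 ->
  tau m a != tau m a.+1.
(* The sites [jx] and [jy] on the two sides of the triangle carry a term of p
   not detected by the signs; they act as corners when q vanishes there. *)
Hypothesis left_free : forall k, k.+1 = jy ->
  P k.+1 0 /\ ((k < m)%N -> tau k 0 != tau k.+1 0).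
Hypothesis right_free : forall k, k.+1 = jx ->
  P k.+1 k.+1 /\ ((k < m)%N -> tau k k != tau k.+1 k.+1).
Hypotheses (jx_bd : (0 < jx <= m.+1)%N) (jy_bd : (0 < jy <= m.+1)%N).

Let within k := (\sum_(a < k) (tau k a == tau k a.+1))%N.
Let across k :=
  (\sum_(a < k.+1) ((tau k a == tau k.+1 a.+1) + (tau k a == tau k.+1 a)))%N.
Let terms k := (\sum_(a < k.+1) P k a)%N.
Let free (k : nat) := ((k == jx) + (k == jy))%N.

(** Pigeonhole on the triangle (k,a), (k+1,a), (k+1,a+1): two of three binary signs agree. *)
Lemma up_triangles k : (k.+1 <= across k + within k.+1)%N.
Proof.
rewrite /across /within -big_split /= -{1}[k.+1]card_ord -sum1_card.
apply: leq_sum => a _.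
by case: (tau k a); case: (tau k.+1 a); case: (tau k.+1 a.+1).
Qed.

(** A triangle (k,a), (k,a+1), (k+1,a+1) has at most one equal edge, or three if p has a term at its
    last site; hence the weight 2. An edge along a side has equal ends only next to a term, while a
    free site supplies a term and no equal edge, a surplus of 2. *)
Lemma down_triangles k : (k < m)%N ->
  (across k + within k + 2 * free k.+1 <= k + 2 * terms k.+1)%N.
Proof.
move=> km.
have -> : across k = ((tau k k == tau k.+1 k.+1) + (tau k 0 == tau k.+1 0)
   + \sum_(a < k) ((tau k a == tau k.+1 a.+1) + (tau k a.+1 == tau k.+1 a.+1)))%N.
  rewrite /across !big_split /= big_ord_recr /= [X in (_ + X)%N]big_ord_recl /=.
  under [X in (_ + (_ + X))%N]eq_bigr do rewrite /bump /= add1n.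
  lia.
have -> : terms k.+1 = (P k.+1 0 + P k.+1 k.+1 + \sum_(a < k) P k.+1 a.+1)%N.
  rewrite /terms big_ord_recl big_ord_recr /= /bump /= add1n.
  by under eq_bigr do rewrite /bump /= add1n; lia.
have inner : (\sum_(a < k) ((tau k a == tau k.+1 a.+1) + (tau k a.+1 == tau k.+1 a.+1))
    + within k <= k + 2 * \sum_(a < k) P k.+1 a.+1)%N.
  rewrite /within -big_split /= big_distrr /= -[X in (_ <= X + _)%N]card_ord -sum1_card.
  rewrite -big_split /=; apply: leq_sum => a _.
  have := inner_mixed km (ltn_ord a).
  case: (P k.+1 a.+1) => [_|/(_ isT)];
  by case: (tau k a); case: (tau k a.+1); case: (tau k.+1 a.+1).
have left : ((tau k 0 == tau k.+1 0) + 2 * (k.+1 == jy) <= 2 * P k.+1 0)%N.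
  case: (k.+1 =P jy) => [e|_].
    by have [-> /(_ km) /negbTE ->] := left_free e.
  by have := left_mixed km; case: (P k.+1 0) => [_|/(_ isT)/negbTE->//]; case: eqVneq.
have right : ((tau k k == tau k.+1 k.+1) + 2 * (k.+1 == jx) <= 2 * P k.+1 k.+1)%N.
  case: (k.+1 =P jx) => [e|_].
    by have [-> /(_ km) /negbTE ->] := right_free e.
  by have := right_mixed km; case: (P k.+1 k.+1) => [_|/(_ isT)/negbTE->//]; case: eqVneq.
rewrite /free; lia.
Qed.

Lemma top_row : (within m + 2 * free m.+1 <= 2 * terms m.+1)%N.
Proof.
have -> : terms m.+1 = (P m.+1 0 + P m.+1 m.+1 + \sum_(a < m) P m.+1 a.+1)%N.
  rewrite /terms big_ord_recl big_ord_recr /= /bump /= add1n.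
  by under eq_bigr do rewrite /bump /= add1n; lia.
have inner : (within m <= \sum_(a < m) P m.+1 a.+1)%N.
  apply: leq_sum => a _; have := top_mixed (ltn_ord a).
  by case: (P m.+1 a.+1) => [_|/(_ isT)/negbTE->//]; case: eqVneq.
have left : (2 * (m.+1 == jy) <= 2 * P m.+1 0)%N.
  by case: eqP => [/left_free[->]|].
have right : (2 * (m.+1 == jx) <= 2 * P m.+1 m.+1)%N.
  by case: eqP => [/right_free[->]|].
rewrite /free; lia.
Qed.

Lemma sum_free : (\sum_(k < m.+1) free k.+1 = 2)%N.
Proof.
have one j : (0 < j <= m.+1)%N -> (\sum_(k < m.+1) (k.+1 == j))%N = 1%N.
  case: j => // j /= jm; rewrite (bigD1 (Ordinal jm)) //= eqxx big1 // => k.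
  by rewrite -val_eqE /= eqSS => /negbTE ->.
by rewrite big_split /= !one.
Qed.

Lemma count_terms : (m.+4 <= 2 * \sum_(k < m.+1) \sum_(a < k.+2) P k.+1 a)%N.
Proof.
(* Combining the two triangle counts cancels [across k] and gains 1 per row. With [top_row], the two
   free sites then add 4 to m. *)
have tele k : (k <= m)%N ->
    (k + 2 * \sum_(i < k) free i.+1 <= within k + 2 * \sum_(i < k) terms i.+1)%N.
  elim: k => [|k IH] km; first by rewrite !big_ord0.
  rewrite !big_ord_recr /=.
  have := IH (ltnW km); have := up_triangles k; have := down_triangles km.
  move: (across k) (within k) (within _) (free _) (terms _) (\sum_(i < k) _)%N.
  move: (\sum_(i < k) _)%N => ? ? ? ? ? ? ?; lia.
have := tele m (leqnn m); have := top_row; have := sum_free.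
rewrite big_ord_recr /=.
rewrite -/(\sum_(k < m.+1) terms k.+1)%N big_ord_recr /=.
move: (within m) (free _) (terms _) (\sum_(i < m) _)%N (\sum_(i < m) _)%N.
move=> ? ? ? ? ?; lia.
Qed.

End RowCount.

(** * Extending the signs of q to its zeros *)

Section SignFilling.
Variables (R : realDomainType) (m : nat) (Q P : nat -> nat -> R).
Hypothesis row_neq0 : forall k, (k <= m)%N -> exists2 a, (a <= k)%N & Q k a != 0.
Hypothesis top_eq0 : forall a, (a <= m.+1)%N -> Q m.+1 a = 0.
Hypothesis inner_rec : forall k a, (a < k)%N ->
  P k.+1 a.+1 = Q k a + Q k a.+1 - Q k.+1 a.+1.
Hypothesis left_rec : forall k, P k.+1 0 = Q k 0 - Q k.+1 0.
Hypothesis right_rec : forall k, P k.+1 k.+1 = Q k k - Q k.+1 k.+1.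

Let beyond k a := [forall i : 'I_k.+1, (a <= i)%N ==> (Q k i == 0)].
(* Zeros beyond the last nonzero entry of the row alternate with [a], the others
   with [k - a], so that zeros also alternate along both sides of the triangle;
   the phases [ex] and [ey] remain free. *)
Let fill (ex ey : bool) k a : bool :=
  if Q k a != 0 then odd k (+) (0 < Q k a)
  else if beyond k a then ex (+) odd a else ey (+) odd (k - a).

Lemma beyond_recl k a : (a < k)%N -> Q k a = 0 -> beyond k a = beyond k a.+1.
Proof.
move=> ak Qa; apply/forallP/forallP => H i; apply/implyP => ai.
  exact: (implyP (H i) (ltnW ai)).
move: ai; rewrite leq_eqVlt => /orP[/eqP <-|ai]; first by rewrite Qa.
exact: (implyP (H i) ai).
Qed.

Lemma beyond_last k : Q k k = 0 -> beyond k k.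
Proof.
move=> Qk; apply/forallP => i; apply/implyP => ki.
have -> : nat_of_ord i = k by apply/eqP; rewrite eqn_leq ki andbT -ltnS.
by rewrite Qk.
Qed.

Lemma beyond0 k : (k <= m)%N -> beyond k 0 = false.
Proof.
move=> /row_neq0[a ak Qa]; apply/forallP => /(_ (Ordinal (ak : (a < k.+1)%N))) /=.
by rewrite (negbTE Qa).
Qed.

Lemma fill_row ex ey k a : (a < k)%N -> Q k a = 0 -> Q k a.+1 = 0 ->
  fill ex ey k a != fill ex ey k a.+1.
Proof.
move=> ak Qa Qa1; rewrite /fill Qa Qa1 eqxx /= (beyond_recl ak Qa).
case: ifP => _ /=; first by case: ex (odd a) => [] [].
by rewrite -(subnSK ak) /=; case: ey (odd _) => [] [].
Qed.

(** The twist by (-1)^degree reverses the sign of a value carried to the next row. *)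
Lemma fill_carry ex ey k a b : Q k a = Q k.+1 b -> Q k a != 0 ->
  fill ex ey k a != fill ex ey k.+1 b.
Proof. by move=> e Qa; rewrite /fill -e Qa /=; case: (odd k); case: (0 < _). Qed.

Lemma fill_left ex ey k : (k < m)%N -> Q k 0 = Q k.+1 0 ->
  fill ex ey k 0 != fill ex ey k.+1 0.
Proof.
move=> km e; have [Q0|] := eqVneq (Q k 0) 0; last exact: fill_carry.
rewrite /fill -e Q0 eqxx /= !beyond0 ?(ltnW km) // !subn0 /=.
by case: ey (odd k) => [] [].
Qed.

Lemma fill_right ex ey k : Q k k = Q k.+1 k.+1 ->
  fill ex ey k k != fill ex ey k.+1 k.+1.
Proof.
move=> e; have [Q0|] := eqVneq (Q k k) 0; last exact: fill_carry.
rewrite /fill -e Q0 eqxx /= !beyond_last -?e //=.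
by case: ex (odd k) => [] [].
Qed.

(** Two zeros alternate along the row; with exactly one zero, the other value is carried over and
    flips. Two nonzero values of equal sign have a sum of that sign, which the twist reverses. *)
Lemma fill_inner ex ey k a : (a < k)%N -> Q k.+1 a.+1 = Q k a + Q k a.+1 ->
  ~~ ((fill ex ey k a == fill ex ey k a.+1) &&
      (fill ex ey k a == fill ex ey k.+1 a.+1)).
Proof.
move=> ak e; apply/negP => /andP[/eqP e1 /eqP e2].
have [Qa|Qa] := eqVneq (Q k a) 0; have [Qb|Qb] := eqVneq (Q k a.+1) 0.
- by have := fill_row ex ey ak Qa Qb; rewrite e1 eqxx.
- have /(fill_carry ex ey)/(_ Qb) : Q k a.+1 = Q k.+1 a.+1 by rewrite e Qa add0r.
  by rewrite -e1 e2 eqxx.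
- have /(fill_carry ex ey)/(_ Qa) : Q k a = Q k.+1 a.+1 by rewrite e Qb addr0.
  by rewrite e2 eqxx.
move: e1; rewrite /fill Qa Qb => /addbI s1.
have s2 : (0 < Q k.+1 a.+1) = (0 < Q k a) /\ Q k.+1 a.+1 != 0.
  rewrite e; case: (ltgtP 0 (Q k a)) Qa s1 => // ha _;
    case: (ltgtP 0 (Q k a.+1)) Qb => // hb _ _.
    by rewrite addr_gt0 // gt_eqF // addr_gt0.
  by rewrite ltNge ltW ?lt_eqF // -oppr_gt0 opprD addr_gt0 ?oppr_gt0.
by move: e2; rewrite /fill Qa s2.1 s2.2 /=; case: (odd k); case: (0 < _).
Qed.

Lemma first_zero (f : nat -> R) : f 0%N != 0 -> f m.+1 = 0 ->
  exists2 j, (j <= m)%N & f j != 0 /\ f j.+1 = 0.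
Proof.
move=> f0 fm; have ex : exists j, f j == 0 by exists m.+1; apply/eqP.
case: (ex_minnP ex) => -[|j] /eqP fj min; first by rewrite fj eqxx in f0.
exists j; first by rewrite -ltnS min // fm.
by split=> //; apply/negP => /min; rewrite ltnn.
Qed.

Lemma count_nonzero_terms :
  (m.+4 <= 2 * \sum_(k < m.+1) \sum_(a < k.+2) (P k.+1 a != 0%R))%N.
Proof.
have Q00 : Q 0 0 != 0 by have [a] := row_neq0 (leq0n m); case: a.
(* Each side of q starts at a nonzero constant and is zero in row m+1. Where it first vanishes, the
   recurrence forces a term of p. *)
have [jx jxm [Qx Qx1]] : exists2 j, (j <= m)%N & Q j j != 0 /\ Q j.+1 j.+1 = 0.
  by apply: (first_zero (f := fun j => Q j j)) => //; apply: top_eq0.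
have [jy jym [Qy Qy1]] : exists2 j, (j <= m)%N & Q j 0 != 0 /\ Q j.+1 0 = 0.
  by apply: (first_zero (f := fun j => Q j 0)) => //; apply: top_eq0.
(* The phases give the first zero on each side the sign opposite to its nonzero predecessor, as free
   sites require. *)
pose ex := ~~ (odd jx (+) (0 < Q jx jx)) (+) odd jx.+1.
pose ey := ~~ (odd jy (+) (0 < Q jy 0)) (+) odd jy.+1.
apply: (@count_terms m (fill ex ey) (fun k a => P k a != 0) jx.+1 jy.+1).
- move=> k a _ ak; rewrite negbK inner_rec // subr_eq0 => /eqP e.
  exact: fill_inner.
- move=> k km; rewrite negbK left_rec subr_eq0 => /eqP; exact: fill_left.
- move=> k km; rewrite negbK right_rec subr_eq0 => /eqP; exact: fill_right.
- move=> a am; rewrite negbK inner_rec // top_eq0; last exact: ltnW.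
  rewrite subr0 addr_eq0 => /eqP e.
  have [Qa|Qa] := eqVneq (Q m a.+1) 0.
    by apply: fill_row => //; rewrite e Qa oppr0.
  rewrite /fill e oppr_eq0 Qa oppr_gt0 lt_neqAle Qa /= leNgt.
  by case: (0 < _); case: (odd m).
- move=> _ [->]; rewrite left_rec Qy1 subr0; split=> // jm.
  rewrite /fill Qy Qy1 eqxx /= beyond0 // /ey /=.
  by case: (odd jy); case: (0 < _).
- move=> _ [->]; rewrite right_rec Qx1 subr0; split=> // jm.
  rewrite /fill Qx Qx1 eqxx /= beyond_last // /ex /=.
  by case: (odd jx); case: (0 < _).
- by rewrite ltnS.
- by rewrite ltnS.
Qed.

End SignFilling.

(** * Polynomial identities on the unit interval *)

Lemma poly_eq0_on_unit_interval (R : numFieldType) (p : {poly R}) :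
  (forall t, 0 <= t <= 1 -> p.[t] = 0) -> p = 0.
Proof.
(* The points 1/(k+1) are distinct, lie in the interval, and outnumber the degree of a nonzero p. *)
move=> H; pose s := [seq k.+1%:R^-1 : R | k <- iota 0 (size p)].
apply: (@roots_geq_poly_eq0 _ p s).
- apply/allP => _ /mapP[k _ ->]; apply/eqP/H.
  by rewrite invr_ge0 ler0n /= invf_le1 ?ltr0n // ler1n.
- rewrite map_inj_uniq ?iota_uniq // => i j /invr_inj /eqP.
  by rewrite eqr_nat => /eqP[].
- by rewrite size_map size_iota.
Qed.

Lemma bernstein_free (R : numFieldType) (k : nat) (c : nat -> R) :
  (forall t, 0 <= t <= 1 -> \sum_(a < k.+1) c a * t ^+ a * (1 - t) ^+ (k - a) = 0) ->
  forall a, (a <= k)%N -> c a = 0.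
Proof.
move=> H; pose p := \poly_(a < k.+1) c a.
suff p0 : p = 0.
  by move=> a ak; rewrite -(coef0 R a) -p0 coef_poly ltnS ak.
apply: poly_eq0_on_unit_interval => s /andP[s0 s1].
have d0 : 0 < 1 + s by rewrite ltr_wpDr.
(* The substitution t = s / (1 + s) turns the sum into p(s) / (1 + s)^k. *)
have := H (s / (1 + s)); rewrite divr_ge0 ?(ltW d0) //= ler_pdivrMr // mul1r.
rewrite lerDr ler01 => /(_ isT) /(congr1 (fun x => x * (1 + s) ^+ k)).
rewrite mul0r mulr_suml => <-; rewrite horner_poly; apply: eq_bigr => a _.
have ak : (a <= k)%N by rewrite -ltnS.
have -> : 1 - s / (1 + s) = (1 + s)^-1 by field; rewrite gt_eqF.
have -> : (1 + s) ^+ k = (1 + s) ^+ a * (1 + s) ^+ (k - a).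
  by rewrite -exprD subnKC.
rewrite expr_div_n exprVn.
by field; rewrite !expf_neq0 ?gt_eqF.
Qed.


(** * The quotient (1 - p) / (1 - x - y) *)

Section Quotient.
Variables (R : realType) (n : nat) (M : reduced_model R n).

Let deg i := (nu M i + mu M i)%N.
Let term (t : R) i := scaling M i * t ^+ nu M i * (1 - t) ^+ mu M i.

Definition model_coef (k a : nat) : R :=
  \sum_(i < n.+1 | (deg i == k) && (nu M i == a)) scaling M i.

(** Coefficient of x^a y^(k-a) in the power series (1 - p) / (1 - x - y), obtained by comparing
    coefficients in (1 - x - y) q = 1 - p. Row 0 is 1 because p has no constant term. *)
Fixpoint quotient_coef (k a : nat) : R :=
  if k is k'.+1 then
    (if a is a'.+1 then quotient_coef k' a' else 0) + quotient_coef k' a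
      - model_coef k a
  else (a == 0%N)%:R.

Lemma quotient_coef_gt k a : (k < a)%N -> quotient_coef k a = 0.
Proof.
elim: k a => [|k IH] [|a] //= ka.
rewrite !IH //; last exact: ltnW.
rewrite /model_coef big_pred0 ?subr0 ?addr0 // => i.
by apply/negP => /andP[/eqP]; rewrite /deg => + /eqP; lia.
Qed.

Lemma sum_model_coef k t :
  \sum_(a < k.+1) model_coef k a * t ^+ a * (1 - t) ^+ (k - a) =
  \sum_(i < n.+1 | deg i == k) term t i.
Proof.
under eq_bigr do rewrite /model_coef !mulr_suml.
rewrite (exchange_big_dep (fun i => deg i == k)) /=; last by move=> a i _ /andP[].
apply: eq_bigr => i /eqP di.
have ik : (nu M i < k.+1)%N by rewrite ltnS -di leq_addr.
rewrite (big_pred1 (Ordinal ik)) /=; last first.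
  by move=> a; rewrite di eqxx /= eq_sym -val_eqE.
by rewrite /term -{1}di /deg addKn.
Qed.

(** On the line x + y = 1, multiplying row k by x + y preserves its value, so passing to row k+1
    only subtracts the terms of p of degree k+1. *)
Lemma sum_quotient_coef k t :
  \sum_(a < k.+1) quotient_coef k a * t ^+ a * (1 - t) ^+ (k - a) =
  1 - \sum_(i < n.+1 | (deg i <= k)%N) term t i.
Proof.
elim: k => [|k IH].
  rewrite big_ord1 /= big_pred0 => [|i]; first by rewrite subr0 !mulr1.
  apply/negP; rewrite leqn0 addn_eq0 => /andP[/eqP e1 /eqP e2].
  by apply: (@exponents_neq0 _ _ M i); rewrite e1 e2.
have -> : \sum_(i < n.+1 | (deg i <= k.+1)%N) term t i =
    \sum_(i < n.+1 | (deg i <= k)%N) term t i + \sum_(i < n.+1 | deg i == k.+1) term t i.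
  rewrite (bigID (fun i => (deg i <= k)%N)) /=; congr (_ + _).
    by apply: eq_bigl => i; lia.
  by apply: eq_bigl => i; lia.
rewrite opprD addrA -IH -sum_model_coef /=.
under eq_bigr do rewrite !mulrBl !mulrDl.
rewrite sumrB big_split /=; congr (_ - _).
rewrite [X in X + _ = _]big_ord_recl [X in _ + X = _]big_ord_recr /=.
rewrite quotient_coef_gt // !mul0r add0r addr0.
rewrite -big_split /=; apply: eq_bigr => a _.
rewrite /bump /= add1n subSS exprS subSn; last by rewrite -ltnS.
by rewrite exprS; ring.
Qed.

Lemma quotient_row_neq0 k : (k < degree M)%N ->
  exists2 a, (a <= k)%N & quotient_coef k a != 0.
Proof.
move=> kd.
case: (boolP [exists a : 'I_k.+1, quotient_coef k a != 0])
  => [/existsP[a Qa]|/existsPn H].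
  by exists a; rewrite // -ltnS.
have h1 : 1 - 2%:R^-1 = 2%:R^-1 :> R by field.
have tgt0 i : 0 < term 2%:R^-1 i.
  by rewrite /term h1 !mulr_gt0 ?exprn_gt0 ?scaling_gt0 ?invr_gt0 ?ltr0n.
have := sum_quotient_coef k 2%:R^-1.
rewrite big1 => [|a _]; last by rewrite (eqP (negbNE (H a))) !mul0r.
move=> /esym/subr0_eq; have half : 0 <= (2%:R^-1 : R) <= 1 by lra.
move=> /(etrans (scaling_sum M half)).
rewrite (bigID (fun i => (deg i <= k)%N)) /= -[RHS]addr0 => /addrI/eqP.
rewrite psumr_eq0 => [/allP all0|i _]; last exact/ltW/tgt0.
suff : (degree M <= k)%N by rewrite leqNgt kd.
apply/bigmax_leqP => i _; rewrite leqNgt; apply/negP => ki.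
by have := all0 i (mem_index_enum i); rewrite -ltnNge ki /= (gt_eqF (tgt0 i)).
Qed.

(** Up to this degree all terms of p are subtracted, so the row vanishes on x + y = 1, and Bernstein
    polynomials are independent. *)
Lemma quotient_top_eq0 a : (a <= degree M)%N -> quotient_coef (degree M) a = 0.
Proof.
apply: (@bernstein_free R (degree M) (quotient_coef (degree M))) => t t01.
rewrite sum_quotient_coef -(scaling_sum M t01).
rewrite [X in _ - X](eq_bigl predT) ?subrr // => i.
exact: (leq_bigmax i).
Qed.

Lemma degree_bound : (0 < degree M)%N -> (degree M + 3 <= 2 * n.+1)%N.
Proof.
case dE: (degree M) => [//|m] _.
have cnt := @count_nonzero_terms R m quotient_coef model_coef.
have {}cnt : (m.+4 <= 2 * \sum_(k < m.+1) \sum_(a < k.+2) (model_coef k.+1 a != 0%R))%N.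
  apply: cnt => [k km|a am|k a ak|k|k].
  - by apply: quotient_row_neq0; rewrite dE.
  - by rewrite -dE quotient_top_eq0 // dE.
  - by rewrite /=; ring.
  - by rewrite /=; ring.
  - by rewrite /= (quotient_coef_gt (ltnSn k)); ring.
suff : (\sum_(k < m.+1) \sum_(a < k.+2) (model_coef k.+1 a != 0%R) <= n.+1)%N by lia.
rewrite -[X in (_ <= X)%N]card_ord -sum1_card.
have row k : (\sum_(a < k.+2) (model_coef k.+1 a != 0%R) <=
    \sum_(i < n.+1 | deg i == k.+1) 1)%N.
  (* [inord] never takes its default value here: an index of degree k+1 has [nu] at most k+1. *)
  rewrite (partition_big (fun i => inord (nu M i) : 'I_k.+2) xpredT) //=.
  apply: leq_sum => a _; case: eqVneq => //= P0.
  rewrite sum1_card lt0n; apply: contra_neq P0 => /card0_eq none.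
  rewrite /model_coef big_pred0 // => i; apply/negP => /andP[di /eqP na].
  by have := none i; rewrite !inE unfold_in di na inord_val eqxx.
apply: (@leq_trans (\sum_(k < m.+1) \sum_(i < n.+1 | deg i == k.+1) 1)%N).
  by apply: leq_sum => k _; exact: row.
rewrite (exchange_big_dep xpredT) //=; apply: leq_sum => i _.
rewrite sum1_card; apply/card_le1P => k; rewrite unfold_in => /eqP ki j.
change ((deg i == j.+1) = (j == k)).
by rewrite ki eqSS eq_sym.
Qed.

End Quotient.

(** * Lower bound on the degree by perturbing the scalings *)

Lemma positive_perturbation (R : realFieldType) (I : finType) (s v : I -> R) :
  (forall i, 0 < s i) -> exists2 e, 0 < e & forall i, 0 < s i + e * v i.
Proof.
move=> s0; pose b := \sum_i `|v i| / s i.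
have b0 i : 0 <= `|v i| / s i by rewrite divr_ge0 // ltW.
have d0 : 0 < 1 + b by rewrite ltr_wpDr // sumr_ge0.
(* As b bounds every |v_i| / s_i, this choice gives e |v_i| < s_i. *)
exists (1 + b)^-1; first by rewrite invr_gt0.
move=> i; have le_b : `|v i| / s i <= b.
  by rewrite /b (bigD1 i) //= lerDl sumr_ge0.
have : `|v i| < s i * (1 + b).
  by rewrite mulrC -ltr_pdivrMr // (le_lt_trans le_b) // ltrDr.
rewrite -ltr_pdivrMr // => lt_s.
have : - ((1 + b)^-1 * v i) <= `|v i| / (1 + b).
  by rewrite mulrC -mulNr ler_pM2r ?invr_gt0 // -normrN ler_norm.
lra.
Qed.

Lemma linear_dependence (R : fieldType) (n d : nat) (p : 'I_n.+1 -> {poly R}) :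
  (d < n)%N -> (forall i, size (p i) <= d.+1)%N ->
  exists2 v : 'I_n.+1 -> R, \sum_i v i *: p i = 0 & exists i, v i != 0.
Proof.
move=> dn sp; pose A := \matrix_(i < n.+1) poly_rV (d := d.+1) (p i).
have : kermx A != 0.
  by rewrite kermx_eq0 /row_free neq_ltn (leq_ltn_trans (rank_leq_col A)).
move=> /rowV0Pn[v /sub_kermxP vA v0]; exists (v 0); last first.
  apply/existsP; apply: contraNT v0 => /existsPn H; apply/eqP/rowP => i.
  by rewrite mxE; apply/eqP/negPn/H.
move: vA; rewrite mulmx_sum_row => /(congr1 rVpoly).
rewrite linear0 linear_sum; apply: etrans.
by apply: eq_bigr => i _; rewrite linearZ rowK /= poly_rV_K.
Qed.

Lemma fundamental_degree_ge (R : realType) (n : nat) (M : reduced_model R n) :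
  fundamental M -> (n <= degree M)%N.
Proof.
move=> fundM; rewrite leqNgt; apply/negP => dn.
pose p i : {poly R} := 'X^(nu M i) * (1 - 'X) ^+ mu M i.
have sp i : (size (p i) <= (degree M).+1)%N.
  apply: leq_trans (size_polyMleq _ _) _; rewrite size_polyXn /=.
  have -> : 1 - 'X = - ('X - 1%:P) :> {poly R} by rewrite opprB.
  rewrite exprNn; apply: (@leq_trans (nu M i + (mu M i).+1)).
    rewrite leq_add2l; apply: leq_trans (size_polyMleq _ _) _.
    rewrite size_exp_XsubC -signr_odd.
    by case: odd; rewrite ?expr0 ?expr1 ?size_polyN size_poly1.
  by rewrite addnS ltnS; apply: (leq_bigmax i).
have [v vp [i0 vi0]] := linear_dependence dn sp.
have [e e0 pos] := positive_perturbation v (scaling_gt0 M).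
have sum1 : \sum_i scaling M i *: p i = 1.
  apply/eqP; rewrite -subr_eq0; apply/eqP/poly_eq0_on_unit_interval => t t01.
  rewrite !hornerE horner_sum -(scaling_sum M t01) -sumrB big1 // => i _.
  by rewrite /p !hornerE; apply: subrr.
have sum_c : \sum_i (scaling M i + e * v i) *: p i = 1.
  under eq_bigr do rewrite scalerDl -scalerA.
  by rewrite big_split /= sum1 -scaler_sumr vp scaler0 addr0.
have /eqP := fundM _ pos sum_c i0.
by rewrite -subr_eq0 addrC addKr mulf_eq0 (negbTE vi0) gt_eqF.
Qed.

Theorem proposition6p1 (R : realType) (n d : nat) (hn : (0 < n)%N)
    (hd : (0 < d)%N) (hnd : (d < n)%N \/ (2 * n - 1 < d)%N) :
  ~ exists M : reduced_model R n, fundamental M /\ degree M = d.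
Proof.
case=> M [fundM dM]; subst d.
have := fundamental_degree_ge fundM; have := degree_bound hd; lia.
Qed.
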